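(* Let $p$ be an odd prime, $m,s$ positive integers, and $\mathcal{R}=\mathbb{F}_{p^m}[u,v]/\langle u^2,v^2,uv-vu\rangle$. Let $\alpha=\alpha_1+\alpha_3v+\alpha_4uv\in\mathcal{R}$ with $\alpha_1,\alpha_3,\alpha_4\in\mathbb{F}_{p^m}^*$, and suppose $\alpha$ is not a square in $\mathcal{R}$. Let $\alpha_0\in\mathbb{F}_{p^m}$ be the element with $\alpha_0^{p^s}=\alpha_1$. Let $\mathcal{C}=\langle u(x^2-\alpha_0)^\ell\rangle$ be the ideal of $\mathcal{R}_\alpha=\mathcal{R}[x]/\langle x^{2p^s}-\alpha\rangle$, where $0\le\ell\le 2p^s-1$. Then the Hamming distance of $\mathcal{C}$ is $$d_H(\mathcal{C})=\begin{cases}1 & \text{if } 0\le\ell\le p^s;\\ (\Gamma+1)p^{\gamma} & \text{if } 2p^s-p^{s-\gamma}+(\Gamma-1)p^{s-\gamma-1}+1\le\ell\le 2p^s-p^{s-\gamma}+\Gamma p^{s-\gamma-1},\\ & \text{where } 1\le\Gamma\le p-1 \text{ and } 0\le\gamma\le s-1.\end{cases}$$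
   Context: Elements of $\mathcal{R}_\alpha=\mathcal{R}[x]/\langle x^{2p^s}-\alpha\rangle$ are identified with vectors in $\mathcal{R}^{2p^s}$: the class whose representative of degree less than $2p^s$ is $\zeta_0+\zeta_1x+\cdots+\zeta_{2p^s-1}x^{2p^s-1}$ corresponds to $(\zeta_0,\ldots,\zeta_{2p^s-1})$. Ideals of $\mathcal{R}_\alpha$ are thereby the $\alpha$-constacyclic codes of length $2p^s$ over $\mathcal{R}$. The Hamming weight of a vector is the number of its nonzero entries, and the Hamming distance $d_H(\mathcal{C})$ of a nonzero linear code is the minimum Hamming weight of its nonzero codewords. *)

(* Defs.v *)
From mathcomp Require Import all_boot all_order all_fingroup all_algebra.

Set Implicit Arguments.
Unset Strict Implicit.
Unset Printing Implicit Defensive.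

Import GRing.Theory.
Local Open Scope ring_scope.

(* F[u, v] / <u^2, v^2, uv - vu>, built as (F[u]/<u^2>)[v]/<v^2>; by
   quotuv_monoid_morphism, quotuvD, quotuv_gens, quotuv_surj and quotuv_eq0
   below, it is the quotient of {poly {poly F}} by <u^2, v^2>. *)
Definition Fu (F : fieldType) := {poly %/ ('X^2 : {poly F})}.
Definition Fuv (F : fieldType) := {poly %/ ('X^2 : {poly Fu F})}.

Section Fuv.
Variable F : fieldType.

Definition scal (a : F) : Fuv F := qpolyC 'X^2 (qpolyC 'X^2 a).
Definition elt_u : Fuv F := qpolyC 'X^2 (qpolyX 'X^2).
Definition elt_v : Fuv F := qpolyX 'X^2.

(* In {poly {poly F}} the inner variable plays u and the outer one v. *)
Definition quotuv (P : {poly {poly F}}) : Fuv F :=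
  in_qpoly 'X^2 (map_poly (in_qpoly 'X^2 : {poly F} -> Fu F) P).

End Fuv.

(* The quotient construction {poly %/ h} silently replaces h by 'X unless h is
   monic of positive degree; this is the case here as soon as 0 < n, see
   mk_monic_constacyclic. *)
Definition constacyclic_ring (A : comNzRingType) (n : nat) (a : A) :=
  {poly %/ ('X^n - a%:P : {poly A})}.

Definition cls (A : comNzRingType) (n : nat) (a : A) (P : {poly A}) :
  constacyclic_ring n a := in_qpoly ('X^n - a%:P) P.

Definition principal_ideal (A : comNzRingType) (g : A) : A -> Prop :=
  fun c => exists r : A, c = r * g.

(* The elements of {poly %/ h} are the reduced representatives, so that
   poly_rV reads off (z_0, ..., z_(n-1)) from z_0 + ... + z_(n-1) x^(n-1). *)
Definition code_of (A : comNzRingType) (n : nat) (a : A)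
    (I : constacyclic_ring n a -> Prop) : 'rV[A]_n -> Prop :=
  fun w => exists2 c, I c & w = poly_rV (c : {poly A}).

Definition hamming_weight (A : nzRingType) (n : nat) (w : 'rV[A]_n) : nat :=
  #|[set i : 'I_n | w 0 i != 0]|.

Definition is_hamming_distance (A : nzRingType) (n : nat)
    (C : 'rV[A]_n -> Prop) (d : nat) : Prop :=
  (exists w, [/\ C w, w != 0 & hamming_weight w = d])
  /\ (forall w, C w -> w != 0 -> (d <= hamming_weight w)%N).

Section Checks.
Variable F : fieldType.

Lemma mk_monic_constacyclic (A : comNzRingType) (n : nat) (a : A) :
  (0 < n)%N -> mk_monic ('X^n - a%:P) = 'X^n - a%:P :> {poly A}.
Proof.
by move=> n0; rewrite /mk_monic size_XnsubC // ltnS n0 monicXnsubC.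
Qed.

Lemma in_qpolyX2_eq0 (A : comNzRingType) (P : {poly A}) :
  in_qpoly 'X^2 P = 0 <-> P`_0 = 0 /\ P`_1 = 0.
Proof.
have E : in_qpoly 'X^2 P = take_poly 2 P :> {poly A}.
  rewrite -[P in LHS](poly_take_drop 2) raddfD /= mk_monic_Xn.
  rewrite Pdiv.RingMonic.rmodp_mull ?monicXn // addr0 Pdiv.CommonRing.rmodp_small //.
  by rewrite size_polyXn ltnS size_take_poly.
have C i : (take_poly 2 P)`_i = if (i < 2)%N then P`_i else 0.
  by rewrite coef_take_poly.
split=> [P0|[P0 P1]].
  move: E; rewrite P0 => E.
  by have:= C 0; have:= C 1; rewrite -E /= !coef0 => <- <-.
apply/val_inj; apply/polyP=> i; rewrite -[val _]/(polyn _) E.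
by rewrite C coef0; case: i => [|[|i]].
Qed.

Lemma quotuv_monoid_morphism : monoid_morphism (@quotuv F).
Proof.
by split=> [|P Q]; rewrite /quotuv ?(rmorph1, rmorphM).
Qed.

Lemma quotuvD (P Q : {poly {poly F}}) : quotuv (P + Q) = quotuv P + quotuv Q.
Proof. by rewrite /quotuv !rmorphD. Qed.

Lemma quotuv_gens (a : F) :
  [/\ quotuv a%:P%:P = scal a, quotuv 'X%:P = elt_u F & quotuv 'X = elt_v F].
Proof.
have qC (A : comNzRingType) (b : A) : in_qpoly 'X^2 b%:P = qpolyC 'X^2 b.
  apply/val_inj => /=; rewrite Pdiv.CommonRing.rmodp_small // mk_monic_Xn.
  by rewrite size_polyXn (leq_ltn_trans (size_polyC_leq1 _)).
by rewrite /quotuv !map_polyC map_polyX /= !qC.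
Qed.

Lemma quotuv_surj (x : Fuv F) : exists P, quotuv P = x.
Proof.
have inK (A : comNzRingType) (y : {poly %/ ('X^2 : {poly A})}) :
    in_qpoly 'X^2 (y : {poly A}) = y.
  by apply/val_inj/in_qpoly_small/size_mk_monic.
exists (map_poly (@polyn F _) (x : {poly Fu F})).
rewrite /quotuv -map_poly_comp_id0 ?raddf0 // -[RHS]inK.
by congr in_qpoly; apply: map_poly_id => y _ /=; rewrite inK.
Qed.

Lemma quotuv_eq0 (P : {poly {poly F}}) :
  quotuv P = 0 <-> exists S T, P = S * 'X%:P ^+ 2 + T * 'X ^+ 2.
Proof.
have div2 (A : comNzRingType) (Q : {poly A}) :
    in_qpoly 'X^2 Q = 0 -> Q = drop_poly 2 Q * 'X^2.
  move=> /in_qpolyX2_eq0[Q0 Q1]; rewrite -[LHS](poly_take_drop 2).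
  rewrite (_ : take_poly 2 Q = 0) ?add0r //; apply/polyP=> -[|[|i]];
  by rewrite coef_take_poly coef0.
split=> [/in_qpolyX2_eq0[]|[S [T ->]]].
  rewrite !coef_map => /div2 P0 /div2 P1.
  exists ((drop_poly 2 P`_0)%:P + (drop_poly 2 P`_1)%:P * 'X), (drop_poly 2 P).
  rewrite -[LHS](poly_take_drop 2); congr (_ + _).
  rewrite mulrDl mulrAC -!polyC_exp -!polyCM -P0 -P1.
  apply/polyP=> -[|[|i]]; rewrite coef_take_poly coefD coefC coefCM coefX /=.
  - by rewrite mulr0 addr0.
  - by rewrite mulr1 add0r.
  - by rewrite mulr0 addr0.
have X20 (A : comNzRingType) : in_qpoly 'X^2 ('X^2 : {poly A}) = 0.
  by apply/in_qpolyX2_eq0; rewrite !coefXn.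
have M := quotuv_monoid_morphism.2; rewrite quotuvD (M S) (M T).
rewrite [quotuv ('X ^+ 2)]/quotuv map_polyXn X20 mulr0 addr0.
by rewrite /quotuv -polyC_exp map_polyC /= X20 polyC0 raddf0 mulr0.
Qed.

End Checks.

(* Main.v *)
From HB Require Import structures.
Require Import Defs.
From mathcomp Require Import all_boot all_order all_fingroup all_algebra.
From mathcomp Require Import finfield ring zify.
Import GRing.Theory.
Local Open Scope ring_scope.

(** In the constacyclic ring (x^2 - a0)^(p^s) = v (a3 + a4 u), hence
    u (x^2 - a0)^(p^s) = a3 u v. For l <= p^s the code thus contains the word
    u v of weight 1. For l = p^s + t, since u v annihilates u and v, the
    codewords are the u v f with f in F[x] of degree < 2 p^s divisible by
    (x^2 - a0)^t, and their weight is the number of nonzero coefficients of f.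

    That number is bounded below by induction on g. For g = 0, the Euler
    operator of z = x^(2 p^(s-1)), shifted by an integer, kills a nonzero
    coefficient of f at the cost of a single factor z - b. For the step,
    f = (z - b)^(p-1) h with deg h < 2 p^(s-1), and as
    (z - b)^(p-1) = sum_i b^(p-1-i) z^i, the weight of f is p times that of h.
    A power of x^2 - a0 attains the bound. *)

(** * Hamming weights of polynomials *)

Definition wt (A : nzRingType) (N : nat) (f : {poly A}) : nat :=
  (\sum_(i < N) (f`_i != 0)%R)%N.
Arguments wt {A}.

Lemma hamming_weight_poly_rV (A : nzRingType) (N : nat) (f : {poly A}) :
  hamming_weight (poly_rV f : 'rV_N) = wt N f.
Proof.
rewrite /hamming_weight /wt -sum1_card big_mkcond; apply: eq_bigr => i _.
by rewrite inE mxE; case: (_ == _).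
Qed.

Lemma wt_gt0 (A : nzRingType) (N : nat) (f : {poly A}) :
  f != 0 -> (size f <= N)%N -> (0 < wt N f)%N.
Proof.
move=> f0 sf; rewrite lt0n sum_nat_eq0 negb_forall; apply/existsP.
have kN : ((size f).-1 < N)%N by rewrite prednK // lt0n size_poly_eq0.
by exists (Ordinal kN); rewrite /= -/(lead_coef f) lead_coef_eq0 f0.
Qed.

Lemma wt1_leq (A : nzRingType) (N : nat) : (wt N (1 : {poly A}) <= 1)%N.
Proof.
case: N => [|N]; first by rewrite /wt big_ord0.
rewrite /wt big_ord_recl coef1 oner_eq0 big1 // => i _.
by rewrite coef1 eqxx.
Qed.

Lemma wtD (A : nzRingType) (N : nat) (f g : {poly A}) :
  (wt N (f + g) <= wt N f + wt N g)%N.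
Proof.
rewrite -big_split leq_sum // => i _; rewrite coefD.
have [->|_] := eqVneq f`_i 0; first by rewrite add0r.
by case: (_ == _).
Qed.

Lemma wtCM (A : nzRingType) (N : nat) (c : A) (f : {poly A}) :
  (wt N (c%:P * f) <= wt N f)%N.
Proof.
apply: leq_sum => i _; rewrite coefCM.
by have [->|_] := eqVneq f`_i 0; rewrite ?mulr0 ?eqxx //; case: (_ == _).
Qed.

(** Only an inequality, since coefficients pushed to degree [N] or beyond are no longer counted. *)
Lemma wtXnM (A : nzRingType) (N e : nat) (f : {poly A}) :
  (wt N ('X^e * f) <= wt N f)%N.
Proof.
rewrite /wt -!(big_mkord xpredT (fun i => nat_of_bool (_`_i != 0))).
have [Ne|eN] := leqP N e.
  rewrite big_nat big1 // => i /andP[_ iN].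
  by rewrite coefXnM (leq_trans iN Ne) eqxx.
rewrite (big_cat_nat (leq0n e) (ltnW eN)) /= big_nat big1 => [|i /andP[_ ie]].
  rewrite add0n -{1}[e]add0n big_addn.
  rewrite [X in (_ <= X)%N](big_cat_nat (leq0n (N - e)) (leq_subr _ _)) /=.
  apply: leq_trans (leq_addr _ _); apply: leq_sum => i _.
  by rewrite coefXnM ltnNge leq_addl addnK.
by rewrite coefXnM ie eqxx.
Qed.

Lemma wt_sum (A : nzRingType) (N n : nat) (f : 'I_n -> {poly A}) :
  (wt N (\sum_(i < n) f i) <= \sum_(i < n) wt N (f i))%N.
Proof.
elim/big_ind2: _ => [|f1 n1 f2 n2 le1 le2|//].
  by rewrite /wt big1 // => i _; rewrite coef0 eqxx.
exact: leq_trans (wtD _ _ _ _) (leq_add le1 le2).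
Qed.

(** The binomial expansion has [n.+1] terms, and multiplying by a scaled monomial does not raise the
    weight. *)
Lemma wt_XnsubC_exp (A : comNzRingType) (N q n : nat) (b : A) (f : {poly A}) :
  (wt N (('X^q - b%:P) ^+ n * f) <= n.+1 * wt N f)%N.
Proof.
rewrite addrC exprDn mulr_suml (leq_trans (wt_sum _ _ _ _)) //.
have -> : (n.+1 * wt N f = \sum_(i < n.+1) wt N f)%N.
  by rewrite sum_nat_const card_ord.
apply: leq_sum => i _.
rewrite -mulr_natr -!mulrA -exprM -rmorphN -rmorphXn.
rewrite (leq_trans (wtCM _ _ _ _)) // (leq_trans (wtXnM _ _ _ _)) //.
by rewrite -polyC_natr wtCM.
Qed.

Lemma wt_shift_add (A : nzRingType) (q N : nat) (h f : {poly A}) :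
  (size h <= q)%N -> wt (q + N) (h + 'X^q * f) = (wt q h + wt N f)%N.
Proof.
move=> sh; rewrite /wt big_split_ord; congr (_ + _)%N; apply: eq_bigr => i _.
  by rewrite coefD coefXnM /= ltn_ord addr0.
rewrite coefD coefXnM /= ltnNge leq_addr addKn nth_default ?add0r //.
exact: leq_trans sh (leq_addr _ _).
Qed.

(** As [h] has degree below [q], the shifted copies occupy disjoint blocks of degrees and nothing
    cancels. *)
Lemma wt_scaled_copies (R : idomainType) (n q : nat) (c : nat -> R)
    (h : {poly R}) :
  (forall i, c i != 0) -> (size h <= q)%N ->
  wt (n * q) (\sum_(i < n) (c i)%:P * ('X^q ^+ i * h)) = (n * wt q h)%N.
Proof.
elim: n c => [|n IHn] c c0 sh; first by rewrite big_ord0 mul0n [wt _ _]big_ord0.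
rewrite big_ord_recl expr0 mul1r mulSn.
under eq_bigr => i _ do rewrite exprS -mulrA mulrCA.
rewrite -mulr_sumr wt_shift_add; last by rewrite mul_polyC size_scale.
rewrite (IHn (fun i => c i.+1)) //; congr (_ + _)%N.
by apply: eq_bigr => i _; rewrite coefCM mulf_eq0 (negPf (c0 0%N)).
Qed.

(** * The block Euler operator and the critical exponents *)

(* The differential operator [z d/dz] in the variable [z = X^q] acting on
   [sum_(j < q) X^j f_j(z)]. *)
Definition block_euler (A : nzRingType) (q : nat) (f : {poly A}) : {poly A} :=
  \poly_(i < size f) ((i %/ q)%:R * f`_i).
Arguments block_euler {A}.

Lemma coef_block_euler (A : nzRingType) (q : nat) (f : {poly A}) (i : nat) :
  (block_euler q f)`_i = (i %/ q)%:R * f`_i.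
Proof.
by rewrite coef_poly; case: ltnP => // /(nth_default 0) ->; rewrite mulr0.
Qed.

(** Leibniz rule for [z d/dz], where [z d/dz (z - b) = z]. *)
Lemma block_euler_XnsubCM (A : comNzRingType) (q : nat) (b : A) (g : {poly A}) :
  (0 < q)%N ->
  block_euler q (('X^q - b%:P) * g)
    = 'X^q * g + ('X^q - b%:P) * block_euler q g.
Proof.
move=> q0; apply/polyP => i.
rewrite !(coef_block_euler, mulrBl, coefD, coefN, coefXnM, coefCM).
case: ltnP => [iq|qi]; first by rewrite divn_small // !mul0r mulr0 subr0 addr0.
have ->: (i %/ q = ((i - q) %/ q).+1)%N.
  by rewrite -{1}(subnK qi) divnDr // divnn q0 addn1.
by rewrite -natr1; ring.
Qed.

(** [B] need not be a polynomial in [z = X^q], so the operator need not preserve divisibility by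
    [B]. The factor [X^q - b] that is given up pays for this as well, being itself a multiple of
    [B]. *)
Lemma dvdp_block_euler (R : fieldType) (q e : nat) (b : R) (B f : {poly R}) :
  (0 < q)%N -> B %| 'X^q - b%:P -> ('X^q - b%:P) ^+ e.+1 * B %| f ->
  ('X^q - b%:P) ^+ e * B %| block_euler q f.
Proof.
move=> q0 BA /dvdpP[g ->] {f}; rewrite (mulrC g) -mulrA.
elim: e g => [|e IHe] g.
  rewrite expr1 block_euler_XnsubCM // mul1r dvdp_add //; last exact: dvdp_mulr.
  by rewrite mulrA mulrAC dvdp_mulIr.
rewrite [_ ^+ e.+2]exprS -mulrA block_euler_XnsubCM //.
rewrite dvdp_add //; first by rewrite dvdp_mull // mulrA dvdp_mulIl.
by rewrite {1}exprS -mulrA dvdp_mul // IHe.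
Qed.

(* Codewords of weight [(G + 1) p^g] are cut out by this power of [X^r - a]. *)
Definition critical_exp (p n G g : nat) : nat :=
  (p ^ n - p ^ (n - g) + G * p ^ (n - g - 1))%N.

Lemma ltn_critical_exp (p n G g : nat) :
  (0 < p)%N -> (critical_exp p n G g < critical_exp p n G.+1 g)%N.
Proof. by move=> p0; rewrite ltn_add2l ltn_pmul2r // expn_gt0 p0. Qed.

Lemma critical_exp_ltn (p n G g : nat) :
  (g < n)%N -> (G < p)%N -> (critical_exp p n G g < p ^ n)%N.
Proof.
move=> gn Gp; have p0 : (0 < p)%N by apply: leq_ltn_trans Gp.
have lt1 : (G * p ^ (n - g - 1) < p ^ (n - g))%N.
  rewrite -{2}(@subnK 1 (n - g)) ?subn_gt0 // addn1 expnS.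
  by rewrite ltn_pmul2r // expn_gt0 p0.
have : (p ^ (n - g) <= p ^ n)%N by rewrite leq_pexp2l ?leq_subr.
by move: lt1; rewrite /critical_exp; lia.
Qed.

(** * Weight bounds in characteristic [p] *)

Section Weight.
Variables (F : fieldType) (p : nat).
Hypothesis charFp : p \in [char F].

Lemma wt_monomial (N : nat) (f : {poly F}) :
  (size f <= N)%N -> (wt N f <= 1)%N -> f = (lead_coef f)%:P * 'X^((size f).-1).
Proof.
move=> sf; have [->|f0] := eqVneq f 0; first by rewrite lead_coef0 mul0r.
have kN : ((size f).-1 < N)%N by rewrite prednK // lt0n size_poly_eq0.
rewrite /wt (bigD1 (Ordinal kN)) //= -/(lead_coef f) lead_coef_eq0 f0.
rewrite -[X in (_ <= X)%N]addn0 leq_add2l leqn0 sum_nat_eq0 => /forallP W.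
apply/polyP => i; rewrite coefCM coefXn.
have [->|ik] := eqVneq i _; first by rewrite mulr1.
rewrite mulr0; have [iN|Ni] := ltnP i N; last first.
  by rewrite nth_default // (leq_trans sf).
by have := W (Ordinal iN); rewrite -val_eqE /= ik eqb0 negbK => /eqP.
Qed.

(* Subtracting from [block_euler q f] the right multiple of [f] kills the terms
   of [f] in its top block, and costs at most one factor [X^q - b]. *)
Lemma leq_wt_dvdp (q e : nat) (b : F) (B f : {poly F}) :
  (0 < q)%N -> b != 0 -> (1 < size B)%N -> B %| 'X^q - b%:P ->
  f != 0 -> (size f <= p * q)%N -> ('X^q - b%:P) ^+ e * B %| f ->
  (e.+2 <= wt (p * q) f)%N.
Proof.
move=> q0 b0 sB BA; set A := 'X^q - b%:P in BA *.
have coAX k : coprimep A 'X^k.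
  apply: coprimep_expr.
  by rewrite coprimepX rootE !hornerE expr0n eqn0Ngt q0 sub0r oppr_eq0.
elim: e f => [|e IHe] f f0 sf df.
  (* A nonzero [f] of weight at most 1 is a monomial; [B] is coprime to powers of [X], so it would
     divide a nonzero constant. *)
  rewrite ltnNge; apply/negP => /(wt_monomial _ _ sf) fE.
  move: df; rewrite expr0 mul1r fE Gauss_dvdpl; last first.
    by apply: coprimep_dvdr (coAX _); rewrite // coprimep_sym.
  move=> /dvdp_leq; rewrite polyC_eq0 lead_coef_eq0 f0 => /(_ isT).
  by move=> /leq_trans/(_ (size_polyC_leq1 _)); rewrite leqNgt sB.
set k := (size f).-1; set d := (k %/ q)%N.
have kN : (k < p * q)%N by rewrite prednK // lt0n size_poly_eq0.
have dp : (d < p)%N by rewrite ltn_divLR.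
set g := block_euler q f - (d%:R)%:P * f.
have gE i : g`_i = ((i %/ q)%:R - d%:R) * f`_i.
  by rewrite coefB coef_block_euler coefCM mulrBl.
have lt_gf : (wt (p * q) g < wt (p * q) f)%N.
  rewrite /wt !(bigD1 (Ordinal kN) (P := xpredT)) //= gE subrr mul0r eqxx.
  rewrite -/(lead_coef f) lead_coef_eq0 f0 add0n ltnS leq_sum // => i _.
  by rewrite gE mulf_eq0 negb_or; case: (f`_i == 0); rewrite ?andbF ?leq_b1.
have [g0|g0] := eqVneq g 0; last first.
  apply: leq_trans lt_gf; apply: IHe => //.
    apply/leq_sizeP => i Ni; rewrite gE nth_default ?mulr0 //.
    exact: leq_trans sf Ni.
  rewrite dvdp_sub ?dvdp_block_euler // dvdp_mull //.
  by apply: dvdp_trans df; rewrite exprS -mulrA dvdp_mulIr.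
(* If [g = 0], all nonzero coefficients of [f] lie in its top block, because block indices up to
   [d < p] stay distinct in [F]. Then [f] is [X^(d * q)] times a nonzero polynomial of degree below
   [q], which [A] cannot divide. *)
have fE : f = drop_poly (d * q) f * 'X^(d * q).
  rewrite -[LHS](poly_take_drop (d * q)).
  suff -> : take_poly (d * q) f = 0 by rewrite add0r.
  apply/polyP => i; rewrite coef_take_poly coef0; case: ltnP => // idq.
  have /eqP := gE i; rewrite g0 coef0 eq_sym mulf_eq0 => /orP[|/eqP//].
  rewrite subr_eq0 => /eqP eid; move: idq; rewrite -ltn_divLR // => lid.
  have : (d - i %/ q)%:R == 0 :> F by rewrite natrB ?(ltnW lid) // eid subrr.
  rewrite -(dvdn_pcharf charFp) => /dvdn_leq; rewrite subn_gt0 lid => /(_ isT).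
  by move/leq_trans/(_ (leq_subr _ _)); rewrite leqNgt dp.
have : A %| drop_poly (d * q) f.
  rewrite -(Gauss_dvdpl _ (coAX (d * q)%N)) -fE.
  by apply: dvdp_trans df; rewrite exprS -mulrA dvdp_mulIl.
move/dvdp_leq; have -> : drop_poly (d * q) f != 0.
  by apply: contraNneq f0 => h0; rewrite fE h0 mul0r.
rewrite size_XnsubC // size_drop_poly => /(_ isT).
have := ltn_ceil k q0; rewrite -/d mulSn /k => lt1 lt2; exfalso.
by move: (size f) (d * q)%N lt1 lt2; clear; lia.
Qed.

Lemma XnsubC_exp_pchar (r k : nat) (a : F) :
  ('X^r - a%:P) ^+ (p ^ k) = 'X^(r * p ^ k) - (a ^+ (p ^ k))%:P.
Proof.
have pnat : [char {poly F}].-nat (p ^ k)%N.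
  rewrite (eq_pnat _ (pchar_poly _)) pnatX.
  by rewrite (eq_pnat _ (pcharf_eq charFp)) pnat_id ?(pcharf_prime charFp).
by rewrite exprDn_pchar // exprNn_pchar // -exprM -polyC_exp.
Qed.

(** Cancel [X^q - b] between [(X^q - b)^p = X^(q * p) - b^p] and the geometric factorization of the
    right side. *)
Lemma XnsubC_exp_pred_pchar (q : nat) (b : F) :
  (0 < q)%N ->
  ('X^q - b%:P) ^+ p.-1 = \sum_(i < p) (b ^+ (p.-1 - i))%:P * 'X^q ^+ i.
Proof.
move=> q0; have p0 := prime_gt0 (pcharf_prime charFp).
have A0 : 'X^q - b%:P != 0 by rewrite monic_neq0 // monicXnsubC.
apply: (mulfI A0); rewrite -exprS prednK //.
have := XnsubC_exp_pchar q 1 b; rewrite expn1 => ->.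
apply: oppr_inj; rewrite -mulNr !opprB exprM polyC_exp subrXX.
congr (_ * _); apply: eq_bigr => i _.
by rewrite polyC_exp -subn1 -subnDA add1n.
Qed.

Lemma wt_exp_pred_pchar_mul (q : nat) (b : F) (h : {poly F}) :
  (0 < q)%N -> b != 0 -> (size h <= q)%N ->
  wt (p * q) (('X^q - b%:P) ^+ p.-1 * h) = (p * wt q h)%N.
Proof.
move=> q0 b0 sh; rewrite XnsubC_exp_pred_pchar // mulr_suml.
under eq_bigr => i _ do rewrite -mulrA.
rewrite (wt_scaled_copies _ _ _ (fun i => b ^+ (p.-1 - i))) // => i.
by rewrite expf_neq0.
Qed.

Lemma leq_wt_XnsubC_exp_dvdp (r n G g : nat) (a : F) (f : {poly F}) :
  (0 < r)%N -> a != 0 -> (g < n)%N -> f != 0 -> (size f <= r * p ^ n)%N ->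
  ('X^r - a%:P) ^+ (critical_exp p n G g).+1 %| f ->
  (G.+2 * p ^ g <= wt (r * p ^ n) f)%N.
Proof.
move=> r0 a0; have p0 := prime_gt0 (pcharf_prime charFp).
elim: g n f => [|g IHg] [|n] f // gn f0 sf df;
  have q0 : (0 < r * p ^ n)%N by rewrite muln_gt0 r0 expn_gt0 p0.
all: have NE : (r * p ^ n.+1 = p * (r * p ^ n))%N by rewrite expnS mulnCA.
all: have b0 : a ^+ (p ^ n) != 0 by rewrite expf_neq0.
all: rewrite NE in sf *; have AE := XnsubC_exp_pchar r n a.
  rewrite muln1.
  (* Here the exponent is [G * p ^ n + 1]. With [q = r * p ^ n] and [b = a ^+ (p ^ n)], this makes
     [f] a multiple of [(X^q - b)^G * B] for [B = X^r - a]. *)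
  apply: (leq_wt_dvdp _ G _ ('X^r - a%:P) f q0 b0 _ _ f0 sf); last 1 first.
  - rewrite -AE -exprM mulnC -exprSr; move: df.
    by rewrite /critical_exp subn0 subnn add0n subn1.
  - by rewrite size_XnsubC.
  - by rewrite -AE dvdp_exp // expn_gt0 p0.
(* The part [p ^ n * p.-1] of the exponent forms [(X^q - b)^(p-1)]; the rest is the same kind of
   exponent with [n] and [g] lowered by one. *)
have eE : (critical_exp p n.+1 G g.+1).+1
          = (p ^ n * p.-1 + (critical_exp p n G g).+1)%N.
  have le_p : (p ^ (n - g) <= p ^ n)%N by rewrite leq_pexp2l ?leq_subr.
  have pS : (p ^ n.+1 = p ^ n * p.-1 + p ^ n)%N.
    by rewrite addnC -mulnS prednK // -expnSr.
  rewrite /critical_exp !subSS pS; move: le_p.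
  by move: (p ^ (n - g))%N (p ^ n)%N (p ^ n * p.-1)%N (G * _)%N; clear; lia.
have /dvdpP[k fE] := df.
set h := k * ('X^r - a%:P) ^+ (critical_exp p n G g).+1.
have {}fE : f = ('X^(r * p ^ n) - (a ^+ (p ^ n))%:P) ^+ p.-1 * h.
  by rewrite fE eE exprD exprM AE mulrCA.
have h0 : h != 0 by apply: contraNneq f0 => h0; rewrite fE h0 mulr0.
have sh : (size h <= r * p ^ n)%N.
  set M := (_ ^+ p.-1) in fE.
  have monM : M \is monic by rewrite monic_exp ?monicXnsubC.
  have sM : (size M).-1 = (r * p ^ n * p.-1)%N by rewrite size_exp size_XnsubC.
  have sM0 : (0 < size M)%N by rewrite size_poly_gt0 monic_neq0.
  have pq : (p * (r * p ^ n) = r * p ^ n + r * p ^ n * p.-1)%N.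
    by rewrite -mulnS prednK // mulnC.
  move: sf sM sM0; rewrite fE size_monicM // pq.
  by move: (size M) (size h) (r * p ^ n)%N; clear; lia.
rewrite fE wt_exp_pred_pchar_mul // expnS mulnCA leq_pmul2l //.
by apply: IHg => //; rewrite dvdp_mulIr.
Qed.

(** The exponent is [p^(n-g-1) * G + p^(n-g) * (p^g - 1)]. By Frobenius the power is a product of a
    [G]-th and a [(p^g - 1)]-th power of binomials, with at most [G + 1] and [p^g] terms. *)
Lemma wt_XnsubC_exp_le (N r n G g : nat) (a : F) :
  (g < n)%N -> (wt N (('X^r - a%:P) ^+ critical_exp p n G g) <= G.+1 * p ^ g)%N.
Proof.
move=> gn; have p0 := prime_gt0 (pcharf_prime charFp).
have -> : (critical_exp p n G g
          = p ^ (n - g - 1) * G + p ^ (n - g) * (p ^ g).-1)%N.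
  rewrite /critical_exp addnC mulnC; congr (_ + _)%N.
  by rewrite -subn1 mulnBr muln1 -expnD subnK // ltnW.
rewrite exprD !exprM !XnsubC_exp_pchar.
rewrite (leq_trans (wt_XnsubC_exp _ _ _ _ _ _)) // leq_mul2l /=.
rewrite -[X in wt N X]mulr1 (leq_trans (wt_XnsubC_exp _ _ _ _ _ _)) //.
rewrite prednK ?expn_gt0 ?p0 // -[X in (_ <= X)%N]muln1 leq_mul2l.
by rewrite wt1_leq orbT.
Qed.
End Weight.

(** * Multiplication by [u v] in the coefficient ring *)

HB.instance Definition _ (F : fieldType) :=
  GRing.RMorphism.copy (@scal F)
    (qpolyC ('X^2 : {poly Fu F}) \o qpolyC ('X^2 : {poly F})).

(** [X - c1] is the modulus plus [c3 * V + c4 * (U * V)], and [U] annihilates the last term. *)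
Lemma mul_mod_sqr0 (A : comNzRingType) (U V c1 c3 c4 X M : A) :
  U * U = 0 ->
  U * ((X - c1) * M)
    = U * M * (X - (c1 + c3 * V + c4 * (U * V))) + U * V * (c3 * M).
Proof.
move=> UU.
transitivity (U * M * (X - (c1 + c3 * V + c4 * (U * V))) + U * V * (c3 * M)
              + U * U * (V * c4 * M)); first by ring.
by rewrite UU mul0r addr0.
Qed.

(** [U * V] annihilates [c3 * V + c4 * (U * V)], so under [U * V] the modulus may be replaced by
    [X - c1]. *)
Lemma mul_mod_uv (A : comNzRingType) (U V c1 c3 c4 X M : A) :
  U * U = 0 -> V * V = 0 ->
  U * V * (M * (X - c1)) = U * V * M * (X - (c1 + c3 * V + c4 * (U * V))).
Proof.
move=> UU VV; apply/eqP; rewrite -subr_eq0; apply/eqP.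
transitivity (V * V * (U * M * c3) + U * U * (V * V * M * c4)); first by ring.
by rewrite UU VV !mul0r addr0.
Qed.

Section LocalRing.
Variable F : fieldType.
Local Notation u := (elt_u F).
Local Notation v := (elt_v F).

Lemma elt_u_sqr : u * u = 0.
Proof.
have [_ <- _] := quotuv_gens (0 : F); have [_ M] := quotuv_monoid_morphism F.
by rewrite -M -expr2; apply/quotuv_eq0; exists 1, 0; rewrite mul0r addr0 mul1r.
Qed.

Lemma elt_v_sqr : v * v = 0.
Proof.
have [_ _ <-] := quotuv_gens (0 : F); have [_ M] := quotuv_monoid_morphism F.
by rewrite -M -expr2; apply/quotuv_eq0; exists 0, 1; rewrite mul0r add0r mul1r.
Qed.

(** Up to multiples of [u] and [v], which [u * v] annihilates, [z] is its constant term. *)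
Lemma uv_mul_scal (z : Fuv F) : exists a : F, u * v * z = u * v * scal a.
Proof.
have [_ M] := quotuv_monoid_morphism F; have D := @quotuvD F.
have polyE (A : nzRingType) (P : {poly A}) : P = drop_poly 1 P * 'X + (P`_0)%:P.
  apply/polyP => -[|i]; rewrite coefD coefMX coefC /= ?add0r //.
  by rewrite addr0 coef_drop_poly addn1.
have [P <-] := quotuv_surj z; exists P`_0`_0.
have [scE uE vE] := quotuv_gens P`_0`_0.
rewrite {1}[P]polyE [P`_0 in LHS]polyE polyCD polyCM !(D, M) scE uE vE.
set Q := quotuv _; set q := quotuv _.
transitivity (u * Q * (v * v) + u * u * v * q + u * v * scal P`_0`_0);
  first by ring.
by rewrite elt_u_sqr elt_v_sqr mulr0 !mul0r !add0r.
Qed.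

Lemma uv_scal_eq0 (a : F) : (u * v * scal a == 0) = (a == 0).
Proof.
have [_ M] := quotuv_monoid_morphism F.
apply/eqP/eqP => [|->]; last by rewrite rmorph0 mulr0.
have [<- <- <-] := quotuv_gens a; rewrite -!M.
(* Compare coefficients at the monomial [u v], which occurs in no multiple of [u^2] or [v^2]. *)
move/quotuv_eq0 => [S [T /(congr1 (fun P : {poly {poly F}} => P`_1`_1))]].
rewrite mulrAC -polyCM coefCM coefX mulr1 mulrC mul_polyC coefZ coefX mulr1.
by rewrite coefD coefMXn addr0 -polyC_exp coefMC coefMXn.
Qed.

Lemma uv_mul_poly (r : {poly Fuv F}) :
  exists f : {poly F}, (u * v)%:P * r = (u * v)%:P * map_poly (@scal F) f.
Proof.
elim/poly_ind: r => [|r z [f fE]]; first by exists 0; rewrite rmorph0.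
have [a aE] := uv_mul_scal z; exists (f * 'X + a%:P).
rewrite rmorphD rmorphM /= map_polyX map_polyC /= !mulrDr !mulrA fE.
by rewrite -!polyCM aE.
Qed.

Lemma wt_uv_map_scal (n : nat) (f : {poly F}) :
  wt n ((u * v)%:P * map_poly (@scal F) f) = wt n f.
Proof. by apply: eq_bigr => i _; rewrite coefCM coef_map uv_scal_eq0. Qed.

Lemma uv_map_scal_eq0 (f : {poly F}) :
  ((u * v)%:P * map_poly (@scal F) f == 0) = (f == 0).
Proof.
apply/eqP/eqP => [f0|->]; last by rewrite rmorph0 mulr0.
apply/polyP => i; apply/eqP; rewrite coef0 -uv_scal_eq0 -coef_map -coefCM f0.
by rewrite coef0.
Qed.

(** * The ideal generated by [u (x^2 - a0)^l] *)

Section Code.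
Variables (p s : nat) (a0 a1 a3 a4 : F) (alpha : Fuv F).
Hypothesis charFp : p \in [char F].
Hypothesis a3_neq0 : a3 != 0.
Hypothesis a0E : a0 ^+ (p ^ s) = a1.
Hypothesis alphaE : alpha = scal a1 + scal a3 * v + scal a4 * (u * v).

Local Notation N := (2 * p ^ s)%N.
Local Notation B := ('X^2 - a0%:P).
Local Notation uvf f := ((u * v)%:P * map_poly (@scal F) f).
Local Notation gen l := (cls N alpha (u%:P * ('X^2 - (scal a0)%:P) ^+ l)).

Lemma length_gt0 : (0 < N)%N.
Proof. by rewrite muln_gt0 expn_gt0 (prime_gt0 (pcharf_prime charFp)). Qed.

Lemma cls_mul_modulus (P Q : {poly Fuv F}) :
  cls N alpha (P * ('X^N - alpha%:P) + Q) = cls N alpha Q.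
Proof.
apply/val_inj; rewrite /= mk_monic_constacyclic ?length_gt0 //.
have monh := monicXnsubC alpha length_gt0.
by rewrite Pdiv.RingMonic.rmodpD // Pdiv.RingMonic.rmodp_mull // add0r.
Qed.

Lemma cls_polyn (c : constacyclic_ring N alpha) :
  cls N alpha (c : {poly Fuv F}) = c.
Proof. exact/val_inj/in_qpoly_small/size_mk_monic. Qed.

Lemma polyn_cls_uvf (f : {poly F}) :
  (size f <= N)%N -> cls N alpha (uvf f) = uvf f :> {poly Fuv F}.
Proof.
move=> sf; apply: in_qpoly_small.
rewrite mk_monic_constacyclic ?length_gt0 // size_XnsubC ?length_gt0 // ltnS.
apply: leq_trans sf; rewrite mul_polyC (leq_trans (size_scale_leq _ _)) //.
exact: size_poly.
Qed.

Lemma gen_uvf (t : nat) :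
  gen (p ^ s + t) = cls N alpha (uvf (a3%:P * B ^+ t)).
Proof.
have BE : map_poly (@scal F) B = 'X^2 - (scal a0)%:P.
  by rewrite rmorphB /= map_polyXn map_polyC.
rewrite -BE.
(* The multiple of the modulus to add is the one in [mul_mod_sqr0], with [M] the image of
   [B ^+ t]. *)
rewrite -[RHS](cls_mul_modulus (u%:P * map_poly (@scal F) (B ^+ t))); congr cls.
rewrite exprD -!rmorphXn (XnsubC_exp_pchar _ _ charFp) a0E rmorphB !rmorphM /=.
rewrite map_polyXn !map_polyC /= alphaE !polyCD !polyCM.
set U := u%:P; set V := v%:P.
have UU : U * U = 0 by rewrite -polyCM elt_u_sqr.
exact: mul_mod_sqr0.
Qed.

Lemma uvf_in_ideal (l : nat) (f : {poly F}) :
  B ^+ (l - p ^ s) %| f -> principal_ideal (gen l) (cls N alpha (uvf f)).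
Proof.
move=> /dvdpP[k ->]; set l' := (p ^ s + (l - p ^ s))%N.
(* Since [l - p ^ s] is truncated, [l'] is the maximum of [l] and [p ^ s]. The factor of exponent
   [l' - l] raises the generator to [gen l'], and [a3^-1] cancels the [a3] of [gen_uvf]. *)
exists (cls N alpha (map_poly (@scal F) (k * a3^-1%:P)
           * ('X^2 - (scal a0)%:P) ^+ (l' - l))).
have -> : cls N alpha (uvf (k * B ^+ (l - p ^ s)))
  = cls N alpha (map_poly (@scal F) (k * a3^-1%:P)) * gen l'.
  rewrite gen_uvf /cls -rmorphM /= mulrCA -rmorphM /= mulrA -(mulrA k) -polyCM.
  by rewrite mulVf // mulr1.
rewrite /cls -!rmorphM -mulrA; congr (in_qpoly _ (_ * _)).
by rewrite mulrCA -exprD subnK // /l' -leq_subLR.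
Qed.

Lemma ideal_uvf (l : nat) (c : constacyclic_ring N alpha) :
  (p ^ s <= l <= p ^ s + p ^ s)%N -> principal_ideal (gen l) c ->
  exists2 f : {poly F}, B ^+ (l - p ^ s) %| f
    & (size f <= N)%N /\ c = uvf f :> {poly Fuv F}.
Proof.
move=> /andP[le_l l_le] [r ->].
set t := (l - p ^ s)%N; have tE : (p ^ s + t = l)%N by rewrite subnKC.
have [r' r'E] := uv_mul_poly (r : {poly Fuv F}).
have sM : size ('X^N - a1%:P) = N.+1 by rewrite size_XnsubC ?length_gt0.
have M0 : 'X^N - a1%:P != 0 :> {poly F}.
  by rewrite monic_neq0 // monicXnsubC ?length_gt0.
set f0 := r' * (a3%:P * B ^+ t).
have BM : B ^+ t %| 'X^N - a1%:P.
  by rewrite -a0E -(XnsubC_exp_pchar _ _ charFp) dvdp_exp2l // leq_subLR.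
(* Reduction modulo [X^N - a1 = B^(p^s)] bounds the degree and keeps divisibility by [B ^+ t], as
   [t <= p ^ s]. Under [u v] it agrees with reduction modulo [X^N - alpha]. *)
exists (f0 %% ('X^N - a1%:P)).
  by rewrite -dvdp_mod // /f0 mulrA dvdp_mulIr.
have sf : (size (f0 %% ('X^N - a1%:P))%R <= N)%N by rewrite -ltnS -sM ltn_modp.
split=> //; rewrite -polyn_cls_uvf //; congr polyn.
rewrite -tE gen_uvf -[r]cls_polyn /cls -rmorphM -/(cls _ _ _).
rewrite mulrCA mulrA r'E -mulrA -rmorphM /= -/f0 {1}(divp_eq f0 ('X^N - a1%:P)).
rewrite rmorphD mulrDr /= [map_poly _ (_ %/ _ * _)%R]rmorphM rmorphB /=.
rewrite map_polyXn map_polyC /=.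
set k := map_poly _ (_ %/ _)%R.
rewrite -[RHS](cls_mul_modulus ((u * v)%:P * k)) alphaE.
congr (cls _ _ (_ + _)).
rewrite !polyCD !polyCM; apply: mul_mod_uv.
  by rewrite -polyCM elt_u_sqr.
by rewrite -polyCM elt_v_sqr.
Qed.
End Code.
End LocalRing.

(** * The Hamming distance in the two ranges of [l] *)

Theorem theorem4p5 (p m s : nat) (F : finFieldType)
    (p_prime : prime p) (p_odd : odd p) (m_gt0 : (0 < m)%N) (s_gt0 : (0 < s)%N)
    (cardF : #|F| = (p ^ m)%N)
    (a1 a3 a4 : F) (a1_neq0 : a1 != 0) (a3_neq0 : a3 != 0) (a4_neq0 : a4 != 0)
    (alpha : Fuv F)
    (alphaE : alpha = scal a1 + scal a3 * elt_v F
                      + scal a4 * (elt_u F * elt_v F))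
    (alpha_nsq : ~ exists b : Fuv F, alpha = b ^+ 2)
    (a0 : F) (a0E : a0 ^+ (p ^ s) = a1)
    (l : nat) (l_le : (l <= 2 * p ^ s - 1)%N)
    (C : 'rV[Fuv F]_(2 * p ^ s) -> Prop)
    (CE : C = code_of (principal_ideal
                (cls (2 * p ^ s) alpha
                   ((elt_u F)%:P * ('X^2 - (scal a0)%:P) ^+ l)))) :
  ((l <= p ^ s)%N -> is_hamming_distance C 1)
  /\ (forall G g : nat,
        (1 <= G <= p - 1)%N -> (0 <= g <= s - 1)%N ->
        (2 * p ^ s - p ^ (s - g) + (G - 1) * p ^ (s - g - 1) + 1 <= l
           <= 2 * p ^ s - p ^ (s - g) + G * p ^ (s - g - 1))%N ->
        is_hamming_distance C ((G + 1) * p ^ g)).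

Proof.
have charFp := card_finPcharP cardF p_prime; have p0 := prime_gt0 p_prime.
have a0_neq0 : a0 != 0.
  apply: contraNneq a1_neq0 => a00.
  by rewrite -a0E a00 expr0n expn_eq0 eqn0Ngt p0.
have N_gt0 := length_gt0 F p s charFp.
have B_monic : ('X^2 - a0%:P : {poly F}) \is monic by rewrite monicXnsubC.
have codeword (f : {poly F}) : (size f <= 2 * p ^ s)%N ->
    ('X^2 - a0%:P) ^+ (l - p ^ s) %| f ->
    exists w, [/\ C w, hamming_weight w = wt (2 * p ^ s) f & f != 0 -> w != 0].
  move=> sf df.
  set w := (elt_u F * elt_v F)%:P * map_poly (@scal F) f.
  set c := cls (2 * p ^ s) alpha w.
  have cE : c = w :> {poly Fuv F}.
    exact: polyn_cls_uvf charFp _ sf.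
  have wE : hamming_weight (poly_rV (c : {poly Fuv F}) : 'rV_(2 * p ^ s))
            = wt (2 * p ^ s) f.
    by rewrite hamming_weight_poly_rV cE wt_uv_map_scal.
  exists (poly_rV (c : {poly Fuv F})); split=> //.
    rewrite CE; exists c => //.
    exact: (uvf_in_ideal _ _ _ _ _ _ _ _ charFp a3_neq0 a0E alphaE).
  move=> f0; apply/eqP => w0; have := wt_gt0 _ _ _ f0 sf; rewrite -wE w0.
  rewrite /hamming_weight (_ : [set _ | _] = set0) ?cards0 //.
  by apply/setP => i; rewrite !inE mxE eqxx.
split=> [l_leN|G g /andP[G0 Gp] /andP[_ gs] /andP[l_lb l_ub]].
  split; last first.
    move=> w _ /rV0Pn[i wi]; rewrite /hamming_weight card_gt0.
    by apply/set0Pn; exists i; rewrite inE.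
  have s1 : (size (1%R : {poly F}) <= 2 * p ^ s)%N by rewrite size_poly1.
  (* The truncated difference [l - p ^ s] is 0, so [f = 1] is admissible and yields the word
     [u v]. *)
  have [|w [Cw wE w0]] := codeword 1%R s1.
    by rewrite (eqP (l_leN : (l - p ^ s == 0)%N)) expr0.
  exists w; rewrite w0 ?oner_neq0 // wE; split=> //.
  by apply/eqP; rewrite eqn_leq wt1_leq wt_gt0 ?oner_neq0.
have gs' : (g < s)%N by rewrite -(prednK s_gt0) ltnS -subn1.
case: G G0 Gp l_lb l_ub => // G _ Gp; rewrite subn1 /= => l_lb l_ub.
have Gp' : (G.+1 < p)%N by rewrite -(prednK p0) ltnS -subn1.
have crit_lt := critical_exp_ltn p s G.+1 g gs' Gp'.
have crit_gt := ltn_critical_exp p s G g p0.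
have le_p : (p ^ (s - g) <= p ^ s)%N by rewrite leq_pexp2l ?leq_subr.
(* [G] now stands for one less than in the statement. By [le_p] the subtraction in the range of [l]
   does not truncate, so [l - p ^ s] lies above one critical exponent and not above the next. *)
have lbE : ((p ^ s + critical_exp p s G g).+1 <= l)%N.
  by move: l_lb le_p; rewrite /critical_exp; lia.
have ubE : (l <= p ^ s + critical_exp p s G.+1 g)%N.
  by move: l_ub le_p; rewrite /critical_exp; lia.
have lower (f : {poly F}) : (size f <= 2 * p ^ s)%N -> f != 0 ->
    ('X^2 - a0%:P) ^+ (critical_exp p s G g).+1 %| f ->
    ((G.+1 + 1) * p ^ g <= wt (2 * p ^ s) f)%N.
  move=> sf f0 df; rewrite addn1.
  exact: (leq_wt_XnsubC_exp_dvdp _ _ charFp 2 s G g a0).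
split; last first.
  rewrite CE => w [c Ic ->] w0.
  have [|f df [sf cE]] := ideal_uvf _ _ _ _ _ _ _ _ charFp a0E alphaE _ _ _ Ic.
    by lia.
  rewrite hamming_weight_poly_rV cE wt_uv_map_scal; apply: lower => //.
    apply: contraNneq w0 => f0; rewrite cE f0 rmorph0 mulr0.
    by apply/eqP/rowP => i; rewrite !mxE coef0.
  by apply: dvdp_trans df; rewrite dvdp_exp2l //; lia.
(* This exponent is at least [l - p ^ s], so [f] gives a codeword, and it exceeds the previous
   critical exponent, so [lower] applies to [f] and meets the upper bound. *)
set f := ('X^2 - a0%:P) ^+ critical_exp p s G.+1 g.
have f0 : f != 0 by rewrite monic_neq0 // monic_exp.
have sf : (size f <= 2 * p ^ s)%N.
  have sE : (size f).-1 = (2 * critical_exp p s G.+1 g)%N.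
    by rewrite size_exp size_XnsubC.
  move: sE crit_lt; move: (size f) (critical_exp _ _ _ _) (p ^ s)%N.
  by clear; lia.
have [|w [Cw wE w0]] := codeword f sf.
  by rewrite dvdp_exp2l // leq_subLR.
exists w; rewrite w0 // wE; split=> //; apply/eqP; rewrite eqn_leq.
rewrite lower // ?dvdp_exp2l // andbT addn1.
exact: wt_XnsubC_exp_le.
Qed.
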